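(* Assume that the problem $$\mathcal{F}[\xi,u]=f \ \text{ in } Q,\qquad \mathcal{B}u=g\ \text{ on }\Gamma \tag{P}$$ is well-posed, and define $$\mathcal{L}(u,v)=\tfrac12\,\mathrm{dist}(\mathcal{B}u,g)^2+\langle \mathcal{F}[\xi,u]-f,\,v\rangle_{Z,Z^*},\qquad (u,v)\in X\times Z^*.$$ Then: (1) If $u\in X$ is the unique solution of (P), then $(u,v=0)\in X\times Z^*$ is a saddle point of $\mathcal{L}$, that is, $$\mathcal{L}(u,\tilde v)\le \mathcal{L}(u,0)\le \mathcal{L}(\tilde u,0)\qquad \forall\,\tilde u\in X,\ \forall\,\tilde v\in Z^*.$$ (2) Conversely, if $(u,v)\in X\times Z^*$ is a saddle point of $\mathcal{L}$, then $v=0$ and $u\in X$ is the solution of (P).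
   Context: $Q\subset\mathbb{R}^d$ ($d>1$) is a bounded domain with boundary $\partial Q$, and $\Gamma\subset\partial Q$ is the portion of the boundary on which boundary conditions are imposed. $X$ is a (real) Banach space of functions on $Q$, $Z$ is a (real) Hilbert space of functions on $Q$ with dual $Z^*$ and duality pairing $\langle\cdot,\cdot\rangle_{Z,Z^*}$, and $P$ is a (real) Banach space of functions on $\Gamma$. $\mathcal{F}:Q\times X\to Z$ is a (possibly nonlinear) differential operator, written $u\mapsto\mathcal{F}[\xi,u]\in Z$ for $u\in X$ ($\xi$ denotes the variable in $Q$), and $\mathcal{B}:X\to P$ is a boundary operator. The data are $f\in Z$, $g\in P$. The function $\mathrm{dist}(\cdot,\cdot)$ is a metric (measuring the mismatch of boundary data). Well-posedness is in the usual (Hadamard) sense; in particular, for every choice of right-hand side in $Z$ and boundary datum in $P$ the problem has a unique solution in $X$. A pair $(u,v)\in X\times Z^*$ is a saddle point of $\mathcal{L}$ if $\mathcal{L}(u,\tilde v)\le\mathcal{L}(u,v)\le\mathcal{L}(\tilde u,v)$ for all $\tilde u\in X$, $\tilde v\in Z^*$. *)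

(* Defs.v *)
From HB Require Import structures.
From mathcomp Require Import all_boot all_order all_algebra.
From mathcomp Require Import all_classical all_reals all_analysis.

Set Implicit Arguments.
Unset Strict Implicit.
Unset Printing Implicit Defensive.

Import Order.TTheory GRing.Theory Num.Theory.
Import numFieldNormedType.Exports.

Local Open Scope classical_set_scope.
Local Open Scope ring_scope.

Definition boundary (T : topologicalType) (A : set T) : set T :=
  closure A `\` A°.

Definition bounded_domain (R : realType) (d : nat) (Q : set 'rV[R]_d) : Prop :=
  [/\ open Q, connected Q, Q !=set0 & bounded_set Q].

(* [X] is a space of [V]-valued functions on [D]; as for Lebesgue or Sobolev
   spaces, an element of [X] may be a class of functions rather than a function.
   [fs_ae] is the filter of the sets regarded as having full measure: the
   filter [almost_everywhere mu] gives classes modulo equality mu-a.e. and the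
   filter [globally setT] gives genuine functions. [fs_val x] is a
   representative of [x], of which only the values on [D] are relevant. *)
Record function_space (R : realType) (T : Type) (D : set T) (V : lmodType R)
    (X : lmodType R) := FunctionSpace {
  fs_ae : set_system T ;
  fs_ae_filter : Filter fs_ae ;
  fs_val : X -> T -> V ;
  fs_linear : forall (a : R) (x y : X),
    \forall t \near fs_ae, D t -> fs_val (a *: x + y) t = a *: fs_val x t + fs_val y t ;
  fs_inj : forall x y : X,
    (\forall t \near fs_ae, D t -> fs_val x t = fs_val y t) -> x = y }.

Definition equal_on (R : realType) (T : Type) (D : set T) (V X : lmodType R)
    (S : function_space D V X) (x y : X) : Prop :=
  \forall t \near fs_ae S, D t -> fs_val S x t = fs_val S y t.

Record continuous_dual (R : realType) (Z : normedModType R) := Dual {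
  dual_val :> Z -> R ;
  dual_scalar : scalar dual_val ;
  dual_continuous : continuous dual_val }.

Lemma scalar_zero (R : realType) (Z : normedModType R) :
  scalar (fun _ : Z => 0 : R).
Proof. by move=> a x y; rewrite mulr0 addr0. Qed.

Definition dual_zero (R : realType) (Z : normedModType R) : continuous_dual Z :=
  Dual (@scalar_zero R Z) (@cst_continuous Z R 0).

Lemma dual_ext (R : realType) (Z : normedModType R) (v w : continuous_dual Z) :
  (forall z, v z = w z) -> v = w.
Proof.
case: v w => [v sv cv] [w sw cw] /= /funext vw; subst w.
by congr Dual; exact: Prop_irrelevance.
Qed.

Definition pairing (R : realType) (Z : normedModType R) (z : Z) (v : continuous_dual Z) : R :=
  v z.

Definition is_metric (R : realType) (M : Type) (dist : M -> M -> R) : Prop :=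
  [/\ forall x y, 0 <= dist x y,
      forall x y, dist x y = 0 <-> x = y,
      forall x y, dist x y = dist y x &
      forall x y z, dist x z <= dist x y + dist y z].

(* The value [F[xi, u]] of the operator at the point [xi] is
   [fs_val SZ (F u) xi]. *)
Definition solves (R : realType) (T : Type) (Q Gamma : set T)
    (VZ VP : lmodType R) (X Z P : normedModType R)
    (SZ : function_space Q VZ Z) (SP : function_space Gamma VP P)
    (F : X -> Z) (B : X -> P) (f : Z) (g : P) (u : X) : Prop :=
  equal_on SZ (F u) f /\ equal_on SP (B u) g.

(* Well-posedness in the sense of Hadamard: existence, uniqueness and
   continuous dependence on the data. *)
Definition well_posed (R : realType) (T : Type) (Q Gamma : set T)
    (VZ VP : lmodType R) (X Z P : normedModType R)
    (SZ : function_space Q VZ Z) (SP : function_space Gamma VP P)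
    (F : X -> Z) (B : X -> P) : Prop :=
  (forall f g, exists! u, solves SZ SP F B f g u) /\
  (forall sol : Z * P -> X,
     (forall fg, solves SZ SP F B fg.1 fg.2 (sol fg)) -> continuous sol).

Definition lagrangian (R : realType) (X Z P : normedModType R)
    (F : X -> Z) (B : X -> P) (dist : P -> P -> R) (f : Z) (g : P)
    (u : X) (v : continuous_dual Z) : R :=
  2^-1 * dist (B u) g ^+ 2 + pairing (F u - f) v.

Definition saddle_point (R : realType) (U V : Type) (L : U -> V -> R)
    (u : U) (v : V) : Prop :=
  forall (u' : U) (v' : V), L u v' <= L u v <= L u' v.

(* Main.v *)
Require Import Defs.
From HB Require Import structures.
From mathcomp Require Import all_boot all_order all_algebra.
From mathcomp Require Import all_classical all_reals all_analysis.
From mathcomp Require Import ring.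

(** Two facts make the theorem work. In the second component, the Lagrangian is
    affine with slope [F u - f]; since linear functionals are unbounded on any
    nonzero vector, a maximum over the dual exists only when [F u = f], and then
    [v |-> L u v] is constant. In the first component, well-posedness makes
    [u |-> (F u, B u)] surjective, so that the saddle-point inequality can be
    tested at a [u'] with prescribed boundary values and prescribed residual.

    If [u] solves the problem, both terms of [L u v] vanish for every [v], while
    [L u' 0] is half a square, so [(u, 0)] is a saddle point. Conversely, at a
    saddle point [(u, v)] the maximality in [v] gives [F u = f]
    ([saddle_point_residual0]). Comparing with an exact solution, where [L]
    is [0], then forces [dist (B u) g = 0] ([saddle_point_boundary]). Finally
    [L u v = 0], and comparing with a [u'] of residual [z] and exact boundary
    values gives [0 <= v z] for all [z]; a linear functional of constant sign
    is zero ([saddle_point_multiplier0]).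

    That the dual of [Z] is rich enough for the first step is where the Hilbert
    structure is used: the functionals [dot w] are continuous, and [dot h h > 0]
    for [h != 0] ([dual_value]). *)

Set Implicit Arguments.
Unset Strict Implicit.
Unset Printing Implicit Defensive.

Import Order.TTheory GRing.Theory Num.Theory.
Import numFieldNormedType.Exports.

Local Open Scope classical_set_scope.
Local Open Scope ring_scope.

Lemma dot_polarization (R : realType) (Z : normedModType R)
    (dot : {dot Z for idfun}) (dot_norm : forall z : Z, dot z z = `|z| ^+ 2)
    (w z : Z) :
  dot w z = 4^-1 * (`|w + z| ^+ 2 - `|w - z| ^+ 2).
Proof.
have dotC : dot z w = dot w z by rewrite hermC /= expr0 mul1r.
rewrite -!dot_norm !linearDl !linearDr !linearNl !linearNr /= dotC.
by field.
Qed.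

(** Polarization writes the form through the norm, so that continuity of the
    norm suffices and the Cauchy-Schwarz inequality is avoided. *)
Lemma dot_continuous (R : realType) (Z : normedModType R)
    (dot : {dot Z for idfun}) (dot_norm : forall z : Z, dot z z = `|z| ^+ 2)
    (w : Z) :
  continuous (dot w : Z -> R).
Proof.
have -> : (dot w : Z -> R) = fun z => 4^-1 * (`|w + z| ^+ 2 - `|w - z| ^+ 2).
  by apply/funext => z; exact: dot_polarization.
have cvg_sqr_norm (h : Z -> Z) (z l : Z) :
    h x @[x --> z] --> l -> `|h x| ^+ 2 @[x --> z] --> `|l| ^+ 2.
  move=> hl; rewrite expr2; under eq_cvg do rewrite expr2.
  by apply: cvgM; exact: cvg_norm.
move=> z; apply: cvgM; first exact: cvg_cst.
by apply: cvgB; apply: cvg_sqr_norm; [apply: cvgD|apply: cvgB];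
  solve [exact: cvg_cst | exact: cvg_id].
Qed.

Lemma dot_scalar (R : realType) (Z : normedModType R)
    (dot : {dot Z for idfun}) (w : Z) :
  scalar (dot w : Z -> R).
Proof. by move=> a x y; rewrite linearDr linearZr_LR. Qed.

Definition dot_dual (R : realType) (Z : normedModType R)
    (dot : {dot Z for idfun}) (dot_norm : forall z : Z, dot z z = `|z| ^+ 2)
    (w : Z) : continuous_dual Z :=
  Dual (dot_scalar dot w) (@dot_continuous _ _ _ dot_norm w).

Lemma dual_value (R : realType) (Z : normedModType R)
    (dot : {dot Z for idfun}) (dot_norm : forall z : Z, dot z z = `|z| ^+ 2)
    (h : Z) (c : R) :
  h != 0 -> exists v : continuous_dual Z, v h = c.
Proof.
move=> h0; exists (dot_dual dot_norm ((c / `|h| ^+ 2) *: h)) => /=.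
by rewrite linearZl_LR /= dot_norm divfK // sqrf_eq0 normr_eq0.
Qed.

Lemma dual0 (R : realType) (Z : normedModType R) (v : continuous_dual Z) :
  v 0 = 0.
Proof.
by have := dual_scalar v 1 0 0; rewrite scaler0 addr0 mul1r => /eqP;
  rewrite -subr_eq0 opprD addNKr oppr_eq0 => /eqP.
Qed.

Lemma dualN (R : realType) (Z : normedModType R) (v : continuous_dual Z)
    (z : Z) : v (- z) = - v z.
Proof.
by have := dual_scalar v (-1) z 0; rewrite scaleN1r !addr0 dual0 mulN1r addr0.
Qed.

Lemma dual_ge0_eq0 (R : realType) (Z : normedModType R)
    (v : continuous_dual Z) :
  (forall z, 0 <= v z) -> v = dual_zero Z.
Proof.
move=> v_ge0; apply: dual_ext => z /=; apply/eqP.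
by rewrite eq_le v_ge0 andbT -oppr_ge0 -dualN v_ge0.
Qed.

(** Pointwise equality almost everywhere is equality in the space: one direction
    is [fs_inj], and the other holds because a filter contains the full set. *)
Lemma equal_onE (R : realType) (T : Type) (D : set T) (V X : lmodType R)
    (S : function_space D V X) (x y : X) :
  equal_on S x y <-> x = y.
Proof.
split=> [|->]; first exact: fs_inj.
by have := fs_ae_filter S => ?; apply: nearW.
Qed.

Lemma solvesE (R : realType) (T : Type) (Q Gamma : set T)
    (VZ VP : lmodType R) (X Z P : normedModType R)
    (SZ : function_space Q VZ Z) (SP : function_space Gamma VP P)
    (F : X -> Z) (B : X -> P) (f : Z) (g : P) (u : X) :
  solves SZ SP F B f g u <-> F u = f /\ B u = g.
Proof. by rewrite /solves !equal_onE. Qed.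

Lemma metric_refl (R : realType) (M : Type) (dist : M -> M -> R) (x : M) :
  is_metric dist -> dist x x = 0.
Proof. by case=> _ dist0 _ _; apply/dist0. Qed.

Lemma lagrangian_exact_boundary (R : realType) (X Z P : normedModType R)
    (F : X -> Z) (B : X -> P) (dist : P -> P -> R) (dist_metric : is_metric dist)
    (f : Z) (g : P) (u : X) (v : continuous_dual Z) :
  B u = g -> lagrangian F B dist f g u v = v (F u - f).
Proof.
by rewrite /lagrangian /pairing => ->; rewrite metric_refl // expr0n mulr0 add0r.
Qed.

Lemma lagrangian_exact_residual (R : realType) (X Z P : normedModType R)
    (F : X -> Z) (B : X -> P) (dist : P -> P -> R)
    (f : Z) (g : P) (u : X) (v : continuous_dual Z) :
  F u = f -> lagrangian F B dist f g u v = 2^-1 * dist (B u) g ^+ 2.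
Proof. by rewrite /lagrangian /pairing => ->; rewrite subrr dual0 addr0. Qed.

Lemma solution_saddle_point (R : realType) (X Z P : normedModType R)
    (F : X -> Z) (B : X -> P) (dist : P -> P -> R) (dist_metric : is_metric dist)
    (f : Z) (g : P) (u : X) :
  F u = f -> B u = g ->
  saddle_point (lagrangian F B dist f g) u (dual_zero Z).
Proof.
move=> Fu Bu u' v'.
have Lu w : lagrangian F B dist f g u w = 0.
  by rewrite lagrangian_exact_boundary // Fu subrr dual0.
rewrite !Lu lexx.
by rewrite /lagrangian /pairing /= addr0 mulr_ge0 ?sqr_ge0.
Qed.

(** A nonzero residual could be paired with a functional taking a value larger
    than the supposed maximum. *)
Lemma saddle_point_residual0 (R : realType) (X Z P : normedModType R)
    (dot : {dot Z for idfun}) (dot_norm : forall z : Z, dot z z = `|z| ^+ 2)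
    (F : X -> Z) (B : X -> P) (dist : P -> P -> R)
    (f : Z) (g : P) (u : X) (v : continuous_dual Z) :
  saddle_point (lagrangian F B dist f g) u v -> F u = f.
Proof.
move=> uv; apply/eqP; rewrite -subr_eq0; apply/negPn/negP => res_neq0.
have [w w_res] := dual_value dot_norm (v (F u - f) + 1) res_neq0.
have /andP[+ _] := uv u w.
by rewrite /lagrangian /pairing w_res lerD2l gerDl ler10.
Qed.

(** With zero residual at [u], the Lagrangian there is half the squared mismatch
    whatever [v] is, while its value at an exact solution is [0]. *)
Lemma saddle_point_boundary (R : realType) (X Z P : normedModType R)
    (F : X -> Z) (B : X -> P) (dist : P -> P -> R) (dist_metric : is_metric dist)
    (f : Z) (g : P) (u u' : X) (v : continuous_dual Z) :
  saddle_point (lagrangian F B dist f g) u v ->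
  F u = f -> F u' = f -> B u' = g -> B u = g.
Proof.
move=> uv Fu Fu' Bu'; have /andP[_] := uv u' v.
rewrite lagrangian_exact_residual // lagrangian_exact_boundary // Fu' subrr dual0.
rewrite pmulr_rle0 ?invr_gt0 // => sqr_le0.
have [_ dist0 _ _] := dist_metric; apply/dist0/eqP.
by rewrite -sqrf_eq0 eq_le sqr_le0 sqr_ge0.
Qed.

(** Solvability for every right-hand side lets the residual of a competitor with
    exact boundary values range over all of [Z], so minimality in the first
    component makes [v] nonnegative everywhere. *)
Lemma saddle_point_multiplier0 (R : realType) (X Z P : normedModType R)
    (F : X -> Z) (B : X -> P) (dist : P -> P -> R) (dist_metric : is_metric dist)
    (f : Z) (g : P) (u : X) (v : continuous_dual Z) :
  (forall f', exists u', F u' = f' /\ B u' = g) ->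
  saddle_point (lagrangian F B dist f g) u v ->
  F u = f -> B u = g -> v = dual_zero Z.
Proof.
move=> solvable uv Fu Bu; apply: dual_ge0_eq0 => z.
(* this right-hand side makes the residual of [u'] equal to [z] *)
have [u' [Fu' Bu']] := solvable (f + z).
have /andP[_] := uv u' v.
by rewrite !lagrangian_exact_boundary // Fu Fu' subrr dual0 addrC addKr.
Qed.

Theorem theorem2 (R : realType) (d : nat) (d_gt1 : (1 < d)%N)
    (Q Gamma : set 'rV[R]_d)
    (Q_domain : bounded_domain Q) (Gamma_sub : Gamma `<=` boundary Q)
    (X Z P : completeNormedModType R)
    (dotZ : {dot Z for idfun}) (dotZ_norm : forall z : Z, dotZ z z = `|z| ^+ 2)
    (VX VZ VP : lmodType R)
    (SX : function_space Q VX X) (SZ : function_space Q VZ Z)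
    (SP : function_space Gamma VP P)
    (F : X -> Z) (B : X -> P) (f : Z) (g : P)
    (dist : P -> P -> R) (dist_metric : is_metric dist)
    (wp : well_posed SZ SP F B) :
  let L := lagrangian F B dist f g in
  (forall u : X, unique (solves SZ SP F B f g) u ->
     saddle_point L u (dual_zero Z)) /\
  (forall (u : X) (v : continuous_dual Z), saddle_point L u v ->
     v = dual_zero Z /\ unique (solves SZ SP F B f g) u).
Proof.
move=> L; have [ex_unique_sol _] := wp.
have solvable f' : exists u, F u = f' /\ B u = g.
  by have [u [/solvesE]] := ex_unique_sol f' g; exists u.
split=> [u [/solvesE[Fu Bu] _]|u v uv]; first exact: solution_saddle_point.
have Fu : F u = f by exact: saddle_point_residual0 uv.
have [u0 [Fu0 Bu0]] := solvable f.
have Bu : B u = g by exact: saddle_point_boundary uv Fu Fu0 Bu0.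
split; first exact: saddle_point_multiplier0 uv Fu Bu.
have [u1 [sol_u1 u1_unique]] := ex_unique_sol f g.
have sol_u : solves SZ SP F B f g u by apply/solvesE.
by rewrite -(u1_unique u sol_u).
Qed.
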